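(* Let $U$ be a supertropical monoid and $M:=eU$. (i) If $s:M\to U$ is an ig-section in $U$, then the ideal compression $E(s):=E(U,M\cup s(M))$ is an MFCE-relation on $U$ such that each $E(s)$-equivalence class contains at most one tangible element, hence consists of at most $2$ elements. More precisely, the only equivalence classes which are not one-element sets are the classes of the form $[a]_{E(s)}=\{a,s(a)\}$ with $a\in M$, $s(a)\in\mathcal T(U)$. (ii) All these MFCE-relations $E(s)$ are mixing. (iii) The map $s\mapsto E(s)$ is a bijection from the set of all ig-sections in $U$ onto the set of all MFCE-relations $E$ on $U$ with $|[x]_E\cap\mathcal T(U)|\le1$ for every $x\in U$.
   Context: A supertropical monoid is a commutative monoid $(U,\cdot)$ with absorbing element $0$ and a distinguished idempotent $e$ such that $ex=0$ implies $x=0$, together with a total ordering on $eU$ compatible with multiplication and with $0\le a$ for all $a\in eU$. $\mathcal T(U):=U\setminus eU$ (tangible elements), $\mathcal G(U):=eU\setminus\{0\}$. An ig-section (ideal-generating section) in $U$ is a map $s:M\to U$, $M=eU$, with $e\,s(x)=x$ for all $x\in M$ and $s(M)\,U\subset M\cup s(M)$ (i.e. $M\cup s(M)$ is an ideal of the monoid $U$ containing $M$). An MFCE-relation on $U$ is an equivalence relation $E$ with $x\sim_Ey\Rightarrow xz\sim_Eyz$ for all $z\in U$, and $x\sim_Ey\Rightarrow ex=ey$. $[x]_E$ denotes the $E$-class of $x$. $U/E$ is then a supertropical monoid with induced multiplication and distinguished idempotent $[e]_E$, ghost ideal identified with $M$, and $\pi_E:U\to U/E$, $x\mapsto[x]_E$,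 is a transmission. For an ideal $\mathfrak a\supset M$ of $U$, the ideal compression $E(U,\mathfrak a)$ is the equivalence relation with $x\sim y$ iff $x=y$, or $x,y\in\mathfrak a$ and $ex=ey$. An MFCE-relation $E$ is mixing if $\pi_E$ is a mixing transmission, i.e. for any two different elements $x,y\in U\setminus\{0\}$ with $x\sim_Ey$ there is $z\in U$ with $xz\ne0$, $yz\neq 0$ and one of $xz,yz$ in $\mathcal T(U)$, the other in $\mathcal G(U)$ (the condition $\pi_E^{-1}(0)=\{0\}$ being automatic for MFCE-relations). *)

(* Defs.v *)
From HB Require Import structures.
From mathcomp Require Import all_boot.
From mathcomp Require Import boolp classical_sets functions cardinality.
From Corelib Require Import RelationClasses.

Set Implicit Arguments.
Unset Strict Implicit.
Unset Printing Implicit Defensive.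

Local Open Scope classical_set_scope.
Local Open Scope group_scope.

Definition multiples (G : magmaType) (e : G) : set G :=
  [set e * x | x in setT].

(* st_le carries data only on eU: the order axioms say nothing about its
   values elsewhere. *)
HB.mixin Record Monoid_isSupertropical U of monoid.Monoid U := {
  st_mulC : commutative (fun x y : U => x * y);
  st_zero : U;
  st_ghost : U;
  st_le : rel U;
  st_mul0 : forall x : U, st_zero * x = st_zero;
  st_ghost_idem : st_ghost * st_ghost = st_ghost;
  st_ghost_eq0 : forall x : U, st_ghost * x = st_zero -> x = st_zero;
  st_le_anti : {in multiples st_ghost &, antisymmetric st_le};
  st_le_trans : {in multiples st_ghost & &, transitive st_le};
  st_le_total : {in multiples st_ghost &, total st_le};
  st_le_mul : {in multiples st_ghost & &,
    forall a b c, st_le a b -> st_le (a * c) (b * c)};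
  st_le0 : {in multiples st_ghost, forall a, st_le st_zero a}
}.

#[short(type="supertropicalMonoidType")]
HB.structure Definition SupertropicalMonoid :=
  {U of Monoid_isSupertropical U & monoid.Monoid U}.

Section Supertropical.
Variable U : supertropicalMonoidType.
Implicit Types (x y z u : U) (E : U -> U -> Prop) (A : set U).

Definition ghost_ideal : set U := multiples st_ghost.

Definition tangible : set U := ~` ghost_ideal.

Definition ghost : set U := ghost_ideal `\ st_zero.

(* Sections have the subtype of eU as their domain, so that equality of
   sections is equality of functions on eU. *)
Definition ig_section (s : ghost_ideal -> U) :=
  (forall a, st_ghost * s a = set_val a) /\
  (forall a u, (ghost_ideal `|` range s) (s a * u)).

Definition MFCE E :=
  [/\ Equivalence E,
      forall x y z, E x y -> E (x * z) (y * z)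
    & forall x y, E x y -> st_ghost * x = st_ghost * y].

Definition eclass E x : set U := [set y | E x y].

(* Only meant for ideals A containing eU; the definition itself does not
   require this. *)
Definition ideal_compression A : U -> U -> Prop :=
  fun x y => x = y \/ [/\ A x, A y & st_ghost * x = st_ghost * y].

Definition ig_compression (s : ghost_ideal -> U) : U -> U -> Prop :=
  ideal_compression (ghost_ideal `|` range s).

Definition mixing E := forall x y,
  x <> y -> x <> st_zero -> y <> st_zero -> E x y ->
  exists z, [/\ x * z <> st_zero, y * z <> st_zero
    & (tangible (x * z) /\ ghost (y * z)) \/
      (ghost (x * z) /\ tangible (y * z))].

End Supertropical.

Arguments ghost_ideal {U}.
Arguments tangible {U}.
Arguments ghost {U}.

(* Main.v *)
(** An element of the ideal [M U s(M)] lying over the ghost [a] is either [a]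
    or [s a], so the classes of [E(s)] are read off from [s]; mixing then holds
    with the unit as multiplier, since a nontrivial class consists of one ghost
    and one tangible element. Conversely, [E] determines [s]: the value [s a]
    is the tangible element of the class of [a] if there is one, and [a]
    otherwise. *)

Require Import Defs.
From mathcomp Require Import all_boot.
From mathcomp Require Import boolp classical_sets functions cardinality.

Local Open Scope classical_set_scope.
Local Open Scope card_scope.

(** Translates the cardinal bound of the theorem into the uniqueness form in which the arguments
    below use it. *)
Lemma card_le_I1P {T : Type} (A : set T) :
  A #<= `I_1 <-> is_subset1 A.
Proof.
split=> [/pcard_leP[f] x y Ax Ay | A1].
  apply: (@inj _ _ _ f); rewrite ?inE //.
  have := @funS _ _ _ _ f _ Ax; have := @funS _ _ _ _ f _ Ay => /=.
  by case: (f y) (f x) => [|?] // [|?].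
have [->|/set0P[x Ax]] := eqVneq A set0; first exact: card_ge0.
apply: (card_le_trans (B := [set x])).
  by apply: subset_card_le => y Ay; exact: A1.
by rewrite (card_le_eql card_set1) card_lexx.
Qed.

(** Only a bound, since [x] and [y] may coincide: the pair lies in the image of [I_2] under a
    map. *)
Lemma card_set2_le {T : Type} (x y : T) : [set x; y] #<= `I_2.
Proof.
apply: card_le_trans (card_image_le (fun n => if n is 0 then x else y) `I_2).
by apply: subset_card_le => z [->|->]; [exists 0 | exists 1].
Qed.

Section Supertropical.
Local Open Scope group_scope.
Variable U : supertropicalMonoidType.
Implicit Types (x y z u : U) (a b : @ghost_ideal U) (s : @ghost_ideal U -> U).
Implicit Type E : U -> U -> Prop.
Local Notation e := (@st_ghost U).

(** * The ghost ideal $M$ and the ideal $M \cup s(M)$ *)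

Lemma ghost_ideal_mulr x z : ghost_ideal x -> ghost_ideal (x * z).
Proof. by case=> y _ <-; exists (y * z); rewrite ?mulgA. Qed.

Lemma ghost_idealP x : ghost_ideal x <-> e * x = x.
Proof.
by split=> [[y _ <-]|<-]; [rewrite mulgA st_ghost_idem | exists x].
Qed.

Lemma ghost_ideal_val a : ghost_ideal (set_val a).
Proof. exact: set_valP. Qed.

Lemma ghost_idealM x : ghost_ideal (e * x).
Proof. by exists x. Qed.

(** Packaged in the subtype on which sections are defined, so that [s] can be applied to it. *)
Definition ghost_part x : @ghost_ideal U := SigSub (mem_set (ghost_idealM x)).

Lemma set_val_ghost_part x : set_val (ghost_part x) = e * x.
Proof. by []. Qed.

Lemma ghost_part_eq x a : e * x = set_val a -> ghost_part x = a.
Proof. by move=> xa; exact: val_inj. Qed.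

Lemma ig_section_ideal_mulr s x z : ig_section s ->
  (ghost_ideal `|` range s) x -> (ghost_ideal `|` range s) (x * z).
Proof.
move=> [_ s_ideal] [xM|[a _ <-]]; last exact: s_ideal.
by left; exact: ghost_ideal_mulr.
Qed.

(** If $x = s(a)$, then $ex = a$, so the argument of [s] is recovered from [x]. *)
Lemma ig_section_idealP s x : ig_section s ->
  (ghost_ideal `|` range s) x -> x = e * x \/ x = s (ghost_part x).
Proof.
move=> [sK _] [/ghost_idealP->|[a _ <-]]; [by left | right].
by rewrite (@ghost_part_eq _ a).
Qed.

(** Multiplication by $e$ fixes ghosts and sends $s(a)$ to $a$. *)
Lemma ig_section_ghost s a : ig_section s -> ghost_ideal (s a) ->
  s a = set_val a.
Proof. by move=> [sK _] /ghost_idealP <-. Qed.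

(** * The relation $E(s)$ *)

Lemma ig_compression_MFCE s : ig_section s -> MFCE (ig_compression s).
Proof.
move=> sP; split; first split.
- by move=> x; left.
- by move=> x y [->|[? ? ?]]; [left | right].
- move=> x y z [->//|[Ax Ay xy]] [<-|[_ Az yz]]; first by right.
  by right; split=> //; rewrite xy.
(* Compatibility with products rests on $M \cup s(M)$ being an ideal. *)
- move=> x y z [->|[Ax Ay xy]]; [by left | right].
  by split; [exact: ig_section_ideal_mulr.. | rewrite !mulgA xy].
- by move=> x y [->|[]].
Qed.

Lemma ig_compression_val s a : ig_section s ->
  ig_compression s (set_val a) (s a).
Proof.
move=> [sK _]; right; split; [by left; exact: ghost_ideal_val| |].
  by right; exists a.
by rewrite sK; apply/ghost_idealP/ghost_ideal_val.
Qed.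

(** Both elements lie in $\{ex, s(ex)\}$, because $ex = ey$; being distinct, they take one value
    each. *)
Lemma ig_compression_neq s x y : ig_section s -> x <> y ->
  ig_compression s x y ->
  x = e * x /\ y = s (ghost_part x) \/ y = e * x /\ x = s (ghost_part x).
Proof.
move=> sP xNy [//|[Ax Ay xy]].
have yx : ghost_part y = ghost_part x by apply: ghost_part_eq; rewrite -xy.
have := ig_section_idealP _ _ sP Ax; have := ig_section_idealP _ _ sP Ay.
rewrite -xy yx.
move=> [yE|yE] [xE|xE]; [|by right|by left|];
  by case: xNy; rewrite xE -?yE // yE -?xE.
Qed.

(** One of the two is $ex$ and the other $s(ex)$; were the latter in $M$, it would equal $ex$ as
    well. *)
Lemma ig_compression_tangible s x y : ig_section s -> x <> y ->
  ig_compression s x y ->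
  ghost_ideal x /\ tangible y \/ ghost_ideal y /\ tangible x.
Proof.
move=> sP xNy xy.
have [[xE yE]|[yE xE]] := ig_compression_neq _ _ _ sP xNy xy; [left|right].
  split=> [|yM]; first by exists x.
  by apply: xNy; rewrite yE ig_section_ghost // -yE.
split=> [|xM]; first by exists x.
by apply: xNy; rewrite {1}xE ig_section_ghost // -xE.
Qed.

Lemma ig_compression_le1_tangible s x : ig_section s ->
  is_subset1 (eclass (ig_compression s) x `&` tangible).
Proof.
move=> sP y z [xy yT] [xz zT]; apply: contrapT => yNz.
have [[_ Esym Etrans] _ _] := ig_compression_MFCE _ sP.
have yz : ig_compression s y z by apply: Etrans xz; exact: Esym.
by have [[]|[]] := ig_compression_tangible _ _ _ sP yNz yz.
Qed.

(** * The classes of $E(s)$ *)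

Lemma eclass_ig_compression_val s a : ig_section s ->
  eclass (ig_compression s) (set_val a) = [set set_val a; s a].
Proof.
move=> sP; apply/seteqP; split=> y /=; last first.
  by move=> [->|->]; [left | exact: ig_compression_val].
move=> [->|[_ Ay aE]]; first by left.
have eaE : e * set_val a = set_val a by apply/ghost_idealP/ghost_ideal_val.
have yE : ghost_part y = a by apply: ghost_part_eq; rewrite -aE.
have := ig_section_idealP _ _ sP Ay.
by rewrite -aE eaE yE => -[]; [left | right].
Qed.

Lemma eclass_MFCE E x y : MFCE E -> E x y -> eclass E x = eclass E y.
Proof.
move=> [[_ Esym Etrans] _ _] xy; apply/seteqP; split=> z.
  by apply: Etrans; exact: Esym.
exact: Etrans.
Qed.

(** Elements of $M \cup s(M)$ are related to their ghost part, all others only to themselves. *)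
Lemma eclass_ig_compression s x : ig_section s ->
  eclass (ig_compression s) x = [set x] \/
  eclass (ig_compression s) x =
    eclass (ig_compression s) (set_val (ghost_part x)).
Proof.
move=> sP; have [Ax|NAx] := pselect ((ghost_ideal `|` range s) x).
  right; apply: eclass_MFCE; first exact: ig_compression_MFCE.
  right; split=> //; first by left; exact: ghost_ideal_val.
  by rewrite mulgA st_ghost_idem.
by left; apply/seteqP; split=> y /= => [[->//|[]//]|->]; left.
Qed.

Lemma eclass_ig_compression_card s x : ig_section s ->
  eclass (ig_compression s) x #<= `I_2.
Proof.
move=> sP; have [->|->] := eclass_ig_compression s x sP.
  by rewrite -[[set x]]setUid card_set2_le.
by rewrite eclass_ig_compression_val // card_set2_le.
Qed.

Lemma eclass_ig_compression_nontrivial s x : ig_section s ->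
  ~ (exists y, eclass (ig_compression s) x = [set y]) <->
  exists2 a, tangible (s a) &
    eclass (ig_compression s) x = eclass (ig_compression s) (set_val a).
Proof.
move=> sP; split=> [xN1|[a saT ->] [y]].
  have [x1|xE] := eclass_ig_compression s x sP; first by case: xN1; exists x.
  (* If $s(ex)$ were in $M$, the pair $\{ex, s(ex)\}$ would collapse to $\{ex\}$. *)
  exists (ghost_part x) => // sxM; apply: xN1; exists (e * x).
  by rewrite xE eclass_ig_compression_val // ig_section_ghost // setUid.
(* A one-element class would force $s(a) = a$, which lies in $M$. *)
rewrite eclass_ig_compression_val // => ay; apply: saT.
have -> : s a = y by have : [set set_val a; s a] (s a) by [right]; rewrite ay.
have <- : set_val a = y.
  by have : [set set_val a; s a] (set_val a) by [left]; rewrite ay.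
exact: ghost_ideal_val.
Qed.

Lemma ig_compression_mixing s : ig_section s -> mixing (ig_compression s).
Proof.
move=> sP x y xNy xN0 yN0 xy; exists 1; rewrite !mulg1; split=> //.
by have [[]|[]] := ig_compression_tangible _ _ _ sP xNy xy; [right|left].
Qed.

(** The class of $a$ is both $\{a, s(a)\}$ and $\{a, t(a)\}$, which forces $s(a) = t(a)$ even if one
    pair degenerates. *)
Lemma ig_compression_inj s t : ig_section s -> ig_section t ->
  ig_compression s = ig_compression t -> s = t.
Proof.
move=> sP tP st; apply/funext => a.
have : [set set_val a; t a] (s a).
  by rewrite -eclass_ig_compression_val // -st; exact: ig_compression_val.
have : [set set_val a; s a] (t a).
  by rewrite -eclass_ig_compression_val // st; exact: ig_compression_val.
by move=> [->|->] // [->|->].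
Qed.

(** * Recovering the section from the relation *)

Section Surjectivity.
Variable E : U -> U -> Prop.
Hypotheses (EP : MFCE E) (E1 : forall x, is_subset1 (eclass E x `&` tangible)).

Definition section_of_MFCE a : U :=
  xget (set_val a) (eclass E (set_val a) `&` tangible).
Local Notation s := section_of_MFCE.

Lemma section_of_MFCE_rel a : E (set_val a) (s a).
Proof.
rewrite /s; case: xgetP => [y _ []//|_].
by case: EP => -[Erefl _ _] _ _; exact: Erefl.
Qed.

Lemma section_of_MFCE_tangible a x : E (set_val a) x -> tangible x -> s a = x.
Proof. by move=> ax xT; apply: xget_subset1 => //; exact: E1. Qed.

Lemma section_of_MFCE_ghost a : e * s a = set_val a.
Proof.
case: EP => _ _ /(_ _ _ (section_of_MFCE_rel a)) <-.
by apply/ghost_idealP/ghost_ideal_val.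
Qed.

(** Multiplying $a \sim s(a)$ by $u$ gives $au \sim s(a)u$, and $au$ is the ghost part of $s(a)u$.
    So $s(a)u$, if tangible, is the unique tangible element of the class of $au$, that is,
    $s(au)$. *)
Lemma section_of_MFCE_ig : ig_section s.
Proof.
split=> [|a u]; first exact: section_of_MFCE_ghost.
have [?|auT] := pselect (ghost_ideal (s a * u)); first by left.
right; exists (ghost_part (s a * u)) => //.
apply: section_of_MFCE_tangible => //.
rewrite set_val_ghost_part mulgA section_of_MFCE_ghost.
by case: EP => _ EM _; apply: EM; exact: section_of_MFCE_rel.
Qed.

Lemma section_of_MFCEK : ig_compression s = E.
Proof.
have [[Erefl Esym Etrans] _ Eghost] := EP; have sP := section_of_MFCE_ig.
apply/funext => x; apply/funext => y; apply/propext; split.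
  have [->|xNy] := pselect (x = y); first by move=> _; exact: Erefl.
  (* A pair of distinct related elements is $ex, s(ex)$, and these are [E]-related by the choice of
     [s]. *)
  move/(ig_compression_neq _ _ _ sP xNy).
  have := section_of_MFCE_rel (ghost_part x); rewrite set_val_ghost_part.
  move=> es [[xE yE]|[yE xE]]; first by rewrite yE {1}xE.
  by apply: Esym; rewrite yE {2}xE.
(* For the converse it suffices, up to symmetry, to treat a ghost first argument; two tangible
   [E]-related elements coincide by [E1]. *)
have EghostT u v : ghost_ideal u -> E u v -> ig_compression s u v.
  move=> uM uv; right; split; [by left| |exact: Eghost].
  have [?|vT] := pselect (ghost_ideal v); [by left | right].
  exists (ghost_part u) => //; apply: section_of_MFCE_tangible => //.
  by rewrite set_val_ghost_part; have /ghost_idealP-> := uM.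
move=> xy; have [xM|xT] := pselect (ghost_ideal x); first exact: EghostT.
have [yM|yT] := pselect (ghost_ideal y).
  have [[_ sSym _] _ _] := ig_compression_MFCE _ sP.
  by apply: sSym; apply: EghostT => //; exact: Esym.
by left; apply: (E1 x); split.
Qed.

End Surjectivity.

End Supertropical.

Theorem theorem5p3 (U : supertropicalMonoidType) :
  [/\ forall s : @ghost_ideal U -> U, ig_section s ->
        [/\ MFCE (ig_compression s),
            forall x : U, eclass (ig_compression s) x `&` tangible #<= `I_1,
            forall x : U, eclass (ig_compression s) x #<= `I_2,
            forall a : @ghost_ideal U, tangible (s a) ->
              eclass (ig_compression s) (set_val a) = [set set_val a; s a]
          & forall x : U,
              ~ (exists y : U, eclass (ig_compression s) x = [set y]) <->
              (exists2 a : @ghost_ideal U, tangible (s a) &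
                 eclass (ig_compression s) x =
                 eclass (ig_compression s) (set_val a))],
      forall s : @ghost_ideal U -> U, ig_section s -> mixing (ig_compression s)
    & set_bij [set s : @ghost_ideal U -> U | ig_section s]
        [set E : U -> U -> Prop | MFCE E /\
           forall x : U, eclass E x `&` tangible #<= `I_1]
        (fun s => ig_compression s)].
Proof.
split=> [s sP||].
- split; first exact: ig_compression_MFCE.
  + by move=> x; apply/card_le_I1P; exact: ig_compression_le1_tangible.
  + by move=> x; exact: eclass_ig_compression_card.
  + by move=> a _; exact: eclass_ig_compression_val.
  + by move=> x; exact: eclass_ig_compression_nontrivial.
- exact: ig_compression_mixing.
- split=> [s sP|s t|E [EP E1]].
  + split; first exact: ig_compression_MFCE.
    by move=> x; apply/card_le_I1P; exact: ig_compression_le1_tangible.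
  + by rewrite !inE; exact: ig_compression_inj.
  + have {}E1 x := (card_le_I1P _).1 (E1 x).
    by exists (section_of_MFCE U E);
      [exact: section_of_MFCE_ig | exact: section_of_MFCEK].
Qed.
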